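(* Let $\phi\colon\mathbb{C}\to\mathbb{C}$ be a field automorphism which is the extension of an exponential function in $S_1^*$ (i.e. $\phi|_{K^*}\in S_1^*$), let $D=\sum_{j_1=0}^{J_1}\cdots\sum_{j_k=0}^{J_k}c_{j_1\ldots j_k}\partial_1^{j_1}\cdots\partial_k^{j_k}$ ($c_{j_1\ldots j_k}\in\mathbb{C}$) be a differential operator on $K$, and suppose that $\tilde f=\phi\circ D$ satisfies $$\sum_{i=1}^n a_i\tilde f(\alpha_ix+\beta_iy)=\tilde c\cdot(x+y)\qquad(x,y\in K)$$ with some $\tilde c\ne0$. Then for every $c\in\mathbb{C}$ the set of all additive functions $f\colon K\to\mathbb{C}$ satisfying $$\sum_{i=1}^n a_if(\alpha_ix+\beta_iy)=c\cdot(x+y)\qquad(x,y\in K)$$ is $$\frac{c}{\tilde c}\cdot D^{\phi}+S_1^0 .$$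
   Context: Let $n\ge1$ and $a_i,\alpha_i,\beta_i\in\mathbb{C}$ ($i=1,\ldots,n$). Suppose $\mathbb{Q}(\alpha_1,\ldots,\alpha_n,\beta_1,\ldots,\beta_n)$ has transcendence degree $k\geq 1$ over $\mathbb{Q}$. Let $t_1,\ldots,t_k\in\mathbb{C}$ be algebraically independent over $\mathbb{Q}$ such that the algebraic closure of $L=\mathbb{Q}(t_1,\ldots,t_k)$ in $\mathbb{C}$ contains all $\alpha_i,\beta_i$. Let $K\subset\mathbb{C}$ be a finitely generated field containing all $\alpha_i,\beta_i$, with $L\subset K$ and $K$ contained in the algebraic closure of $L$. Put $K^*=K\setminus\{0\}$. $S_1$ is the set of additive functions $g\colon K\to\mathbb{C}$ for which there is a constant $c_g\in\mathbb{C}$ with $\sum_{i=1}^n a_ig(\alpha_ix+\beta_iy)=c_g(x+y)$ for all $x,y\in K$; $S_1^*=\{g|_{K^*}: g\in S_1\}$; $S_1^0$ is the subspace of those $g\in S_1$ satisfying the equation with constant $c_g=0$. An exponential function on $K^*$ is a multiplicative function $K^*\to\mathbb{C}$. $\partial_j$ denotes the derivation $\partial/\partial t_j$ of $L$, extended uniquely to a derivation of the algebraic closure of $L$ (it maps $K$ into $K$); zero powers are the identity, and $D$ is regarded as a map $K\to\mathbb{C}$ in this way. $D^{\phi}:=\sum\phi(c_{j_1\ldots j_k})\,\partial_1^{j_1}\cdots\partial_k^{j_k}$. *)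

(* Defs.v *)
From mathcomp Require Import all_boot all_order all_algebra.
From mathcomp Require Import classical_sets reals.
From mathcomp Require Import mpoly complex.

Set Implicit Arguments.
Unset Strict Implicit.
Unset Printing Implicit Defensive.

Import GRing.Theory Num.Theory.

Local Open Scope ring_scope.
Local Open Scope classical_set_scope.

Section Fields.
Variable C : numFieldType.

Definition field_gen (A : set C) : set C :=
  smallest [set B : set C | divring_closed (mem B)] A.

Definition alg_closure (A : set C) : set C :=
  [set x | exists p : {poly C}, [/\ p \is a polyOver (mem A), p != 0 & root p x]].

Definition finitely_generated (A : set C) : Prop :=
  exists s : seq C, A = field_gen [set` s].

Definition alg_independent (k : nat) (t : 'I_k -> C) : Prop :=
  forall p : {mpoly rat[k]}, (map_mpoly ratr p).@[t] = 0 -> p = 0.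

(* The transcendence degree over Q of the field A is k: A has a transcendence
   basis with k elements. *)
Definition has_trdeg (A : set C) (k : nat) : Prop :=
  exists s : 'I_k -> C,
    [/\ forall i, A (s i), alg_independent s
      & A `<=` alg_closure (field_gen (range s))].

(* d is a derivation of the field A; its values outside A are irrelevant. *)
Definition derivation_on (A : set C) (d : C -> C) : Prop :=
  [/\ forall x, A x -> A (d x),
      forall x y, A x -> A y -> d (x + y) = d x + d y
    & forall x y, A x -> A y -> d (x * y) = d x * y + x * d y].

(* d acts on Q(t_1, ..., t_k) as the formal partial derivative of rational
   functions with respect to t_j. *)
Definition is_partial (k : nat) (t : 'I_k -> C) (j : 'I_k) (d : C -> C) : Prop :=
  forall p q : {mpoly rat[k]},
    let ev (r : {mpoly rat[k]}) := (map_mpoly ratr r).@[t] in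
    q != 0 ->
    d (ev p / ev q) =
      (ev p^`M(j) * ev q - ev p * ev q^`M(j)) / ev q ^+ 2.

(* The composition of the d_i^(j_i), the leftmost operator being d_0^(j_0). *)
Definition monomial_op (k : nat) (d : 'I_k -> C -> C) (j : 'I_k -> nat) :
    C -> C :=
  \big[(fun f g : C -> C => f \o g)/id]_(i < k) iter (j i) (d i).

(* K is a subfield of C with underlying predicate S.  The coefficient family c
   is indexed by the tuples j with j_i <= J i for all i. *)
Definition diff_op (S : {pred C}) (K : subFieldType S) (k : nat)
    (d : 'I_k -> C -> C) (J : 'I_k -> nat)
    (c : {dffun forall i : 'I_k, 'I_(J i).+1} -> C) : K -> C :=
  fun x => \sum_(j : {dffun forall i : 'I_k, 'I_(J i).+1})
             c j * monomial_op d (fun i => j i) (val x).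

Section Equation.
Variables (S : {pred C}) (K : subFieldType S) (n : nat).
Variables (a : 'I_n -> C) (alpha beta : 'I_n -> K).

Definition is_additive (f : K -> C) : Prop := {morph f : x y / x + y}.

Definition solves (c : C) (f : K -> C) : Prop :=
  forall x y : K,
    \sum_(i < n) a i * f (alpha i * x + beta i * y) = c * (val x + val y).

Definition S1 : set (K -> C) :=
  [set g | is_additive g /\ exists c : C, solves c g].

Definition S1_0 : set (K -> C) := [set g | S1 g /\ solves 0 g].

Definition restr_star (f : K -> C) : {x : K | x != 0} -> C := f \o val.

Definition S1_star : set ({x : K | x != 0} -> C) := restr_star @` S1.

End Equation.
End Fields.

(* Main.v *)
(* A differential operator D on K is killed by a power of the commutator with
   multiplication by any u in K.  The function x |-> sum_i a_i phi(D(alpha_i x))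
   is therefore killed by a power of F |-> F(u x) - phi(u) F(x); but by the
   equation with y = 0 it equals ct * x, on which this operator acts as
   multiplication by u - phi(u).  As ct <> 0, phi is the identity on K.  Since
   the partial derivatives map K into K, it follows that phi o D = D^phi, and
   the description of the solution set is then linear algebra. *)
From HB Require Import structures.
Require Import Defs.
From mathcomp Require Import all_boot all_order all_algebra.
From mathcomp Require Import boolp classical_sets reals.
From mathcomp Require Import mpoly complex.
From mathcomp Require Import ring.

Set Implicit Arguments.
Unset Strict Implicit.
Unset Printing Implicit Defensive.

Import GRing.Theory Num.Theory.

Local Open Scope ring_scope.
Local Open Scope classical_set_scope.

(** * Subfields of [C] as closed predicates *)

Section Subfields.
Variable C : numFieldType.

Lemma field_gen_divring_closed (A : set C) :
  divring_closed (mem (field_gen A)).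
Proof.
have genE x : (x \in mem (field_gen A)) = (x \in field_gen A) by [].
split=> [|x y|x y]; rewrite !genE !in_setE.
- by move=> B [[/set_mem]].
- move=> xA yA B BA; have [[_ Bsub _] _] := BA.
  by apply: set_mem; apply: Bsub; apply: mem_set; [apply: xA | apply: yA].
- move=> xA yA B BA; have [[_ _ Bdiv] _] := BA.
  by apply: set_mem; apply: Bdiv; apply: mem_set; [apply: xA | apply: yA].
Qed.

Definition field_gen_pred (A : set C) : {pred C} := fun x => x \in field_gen A.

HB.instance Definition _ (A : set C) := GRing.isDivringClosed.Build C
  (field_gen_pred A) (field_gen_divring_closed A).

Lemma subfield_divring_closed (S : {pred C}) (K : subFieldType S) :
  divring_closed S.
Proof.
have mem_val (x : C) : x \in S -> exists u : K, x = val u.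
  by move=> xS; exists (Sub x xS); rewrite SubK.
split=> [|x y /mem_val[u ->] /mem_val[v ->]|x y /mem_val[u ->] /mem_val[v ->]].
- by rewrite -(rmorph1 (val : K -> C)); apply: valP.
- by rewrite -rmorphB; apply: valP.
- by rewrite -fmorph_div; apply: valP.
Qed.

(** The set is [S] itself; the argument [K] lets instance inference find the proof that [S] is
    closed under division. *)
Definition subfield_pred (S : {pred C}) (K : subFieldType S) : {pred C} := S.

HB.instance Definition _ (S : {pred C}) (K : subFieldType S) :=
  GRing.isDivringClosed.Build C (subfield_pred K) (subfield_divring_closed K).

(** * The field Q(t) as values of rational functions *)

Section RationalFunctions.
Variables (k : nat) (t : 'I_k -> C).

Let ev (p : {mpoly rat[k]}) : C := (map_mpoly ratr p).@[t].

Lemma meval_field_gen (p : {mpoly rat[k]}) :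
  (map_mpoly ratr p).@[t] \in field_gen_pred (range t).
Proof.
rewrite mevalE rpred_sum // => m _; rewrite rpredM //.
  rewrite mcoeff_map_mpoly /ratr.
  by rewrite rpred_div ?rpred_int.
rewrite rpred_prod // => i _; rewrite rpredX //.
by apply: mem_set; apply: sub_gen_smallest; exists i.
Qed.

(** The quotients form a subfield containing each t_i; algebraic independence keeps nonzero
    denominators nonzero at [t]. *)
Lemma field_gen_ratfun (t_indep : alg_independent t) (x : C) :
  field_gen (range t) x ->
  exists p q : {mpoly rat[k]}, q != 0 /\ x = ev p / ev q.
Proof.
have ev_neq0 q : q != 0 -> ev q != 0.
  by apply: contraNneq => /t_indep ->.
have evB p q : ev (p - q) = ev p - ev q by rewrite /ev !rmorphB.
have evM p q : ev (p * q) = ev p * ev q by rewrite /ev !rmorphM.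
have ev1 : ev 1 = 1 by rewrite /ev !rmorph1.
have ev0 : ev 0 = 0 by rewrite /ev !rmorph0.
pose F := [set x | exists p q : {mpoly rat[k]}, q != 0 /\ x = ev p / ev q].
suff: field_gen (range t) `<=` F by apply.
apply: smallest_sub => [|_ [i _ <-]].
  have memE y : (y \in mem F) = (y \in F) by [].
  split=> [|y z|y z]; rewrite !memE !in_setE.
  - by exists 1, 1; rewrite oner_neq0 ev1 divr1.
  - move=> [p [q [q0 ->]]] [r [s [s0 ->]]].
    exists (p * s - r * q), (q * s); split; first by rewrite mulf_neq0.
    rewrite evB !evM.
    by have := ev_neq0 _ q0; have := ev_neq0 _ s0; move=> *; field; apply/andP.
  (* Inversion is total with 0^-1 = 0, so a zero divisor must be treated: the quotient is then 0 = 0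
     / 1. *)
  - move=> [p [q [q0 ->]]] [r [s [s0 ->]]]; have [->|r0] := eqVneq r 0.
      by exists 0, 1; rewrite oner_neq0 ev0 !mul0r invr0 mulr0.
    exists (p * s), (q * r); split; first by rewrite mulf_neq0.
    rewrite !evM.
    have := ev_neq0 _ q0; have := ev_neq0 _ s0; have := ev_neq0 _ r0.
    by move=> *; field; apply/and3P.
exists 'X_i, 1; rewrite oner_neq0; split=> //.
by rewrite ev1 divr1 /ev map_mpolyX mevalXU.
Qed.

Lemma partial_field_gen (t_indep : alg_independent t) (j : 'I_k) (d : C -> C) :
  is_partial t j d ->
  {in field_gen_pred (range t), forall x, d x \in field_gen_pred (range t)}.
Proof.
move=> d_partial x /set_mem/(field_gen_ratfun t_indep)[p [q [q0 ->]]].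
rewrite d_partial // rpred_div ?rpredX ?meval_field_gen //.
by rewrite rpredB ?rpredM ?meval_field_gen.
Qed.

End RationalFunctions.

(** * Derivations on algebraic extensions *)

Lemma derivation_on0 (A : set C) (d : C -> C) :
  A 0 -> derivation_on A d -> d 0 = 0.
Proof. by move=> A0 [_ dD _]; apply: (addrI (d 0)); rewrite -dD // !addr0. Qed.

(* Differentiating p(x) = 0, with p of minimal degree over L, expresses d x as
   - p^d(x) / p'(x). *)
Lemma derivation_algebraic (L S : divringClosed C) (A : set C) (d : C -> C) :
  derivation_on A d -> {subset S <= A} -> {subset L <= S} ->
  {in L, forall x, d x \in L} ->
  {in S, forall x, exists p, [/\ p \is a polyOver L, p != 0 & root p x]} ->
  derivation_on [set` S] d.
Proof.
move=> d_der SA LS dL S_alg; have [_ dD dM] := d_der.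
have inA y : y \in S -> A y by move/SA/set_mem.
split=> [x xS|x y xS yS|x y xS yS]; last 2 first.
- by apply: dD; apply: inA.
- by apply: dM; apply: inA.
have d0 : d 0 = 0.
  by apply: derivation_on0 d_der; apply: inA; rewrite rpred0.
(* The difference is p^d(x), where p^d has the differentiated coefficients; asserting only
   membership in [S] avoids constructing p^d. *)
have d_horner (p : {poly C}) : p \is a polyOver L ->
    d p.[x] - p^`().[x] * d x \in S.
  elim/poly_ind: p => [|p c IHp] pcL.
    by rewrite deriv0 !horner0 d0 mul0r subr0 rpred0.
  have cL : c \in L.
    by have /polyOverP/(_ 0) := pcL; rewrite coefD coefMX coefC /= add0r.
  have pL : p \is a polyOver L.
    apply/polyOverP => i; have /polyOverP/(_ i.+1) := pcL.
    by rewrite coefD coefMX coefC /= addr0.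
  have pxS : p.[x] \in S.
    by apply: rpred_horner => //; apply: polyOverS pL.
  rewrite derivMXaddC !hornerE dD ?dM; try by apply: inA; rewrite ?rpredM // LS.
  have -> : d p.[x] * x + p.[x] * d x + d c - (p.[x] + p^`().[x] * x) * d x =
      (d p.[x] - p^`().[x] * d x) * x + d c by ring.
  by rewrite rpredD ?(rpredM (IHp pL) xS) // LS // dL.
have [p0 [p0L p0_neq0 p0x]] := S_alg x xS.
pose P m := `[< exists p,
  [/\ p \is a polyOver L, p != 0, root p x & size p = m] >].
have exP : exists m, P m by exists (size p0); apply/asboolP; exists p0.
have [m Pm m_min] := ex_minnP exP.
have [p [pL p_neq0 px sz_p]] := asboolW Pm.
(* Otherwise p' would annihilate x with smaller degree; p' is nonzero because p is not constant and
   the characteristic is 0. *)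
have dp_neq0 : p^`().[x] != 0.
  apply/eqP => dpx.
  have p_gt1 : (1 < size p)%N by apply: root_size_gt1 px.
  have dp_neq0 : p^`() != 0.
    apply/eqP => /(congr1 (fun q : {poly C} => q`_(size p).-2))/eqP.
    rewrite coef_deriv coef0 mulrn_eq0 /= prednK ?ltn_predRL //.
    by apply/negP; rewrite -lead_coefE lead_coef_eq0.
  have : (m <= size p^`())%N.
    apply/m_min/asboolP; exists p^`(); split=> //; last exact/rootP.
    exact: polyOver_deriv.
  by rewrite leqNgt -sz_p lt_size_deriv.
have dpxS : p^`().[x] \in S.
  by apply: rpred_horner => //; apply: polyOverS (polyOver_deriv pL).
have := d_horner p pL; rewrite (rootP px) d0 sub0r rpredN => dpxdS.
by rewrite /= -(mulKf dp_neq0 (d x)) mulrC rpred_div.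
Qed.

End Subfields.

(** * Twisted commutators with multiplication *)

Section Twist.
Variables (K C : comNzRingType) (u : K) (b : C).
Implicit Types F G : K -> C.

(* For b the image of u this is the commutator of F with multiplication by u;
   it lowers the order of a differential operator. *)
Definition twist F : K -> C := fun x => F (u * x) - b * F x.

Lemma iter_twistD_scale c F G m :
  iter m twist (fun x => G x + c * F x) =
  fun x => iter m twist G x + c * iter m twist F x.
Proof.
elim: m => //= m ->; apply/funext => x; rewrite /twist.
by ring.
Qed.

Lemma iter_twist0 m : iter m twist (fun=> 0) = fun=> 0.
Proof.
by elim: m => //= m ->; apply/funext => x; rewrite /twist mulr0 subr0.
Qed.

Lemma iter_twist_eq0W m n F :
  (m <= n)%N -> iter m twist F = (fun=> 0) -> iter n twist F = fun=> 0.
Proof. by move=> /subnK <- F0; rewrite iterD F0 iter_twist0. Qed.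

Lemma iter_twist_sum (I : finType) (c : I -> C) (F : I -> K -> C) m :
  iter m twist (fun x => \sum_i c i * F i x) =
  fun x => \sum_i c i * iter m twist (F i) x.
Proof.
elim: m => //= m ->; apply/funext => x; rewrite /twist mulr_sumr -sumrB.
by apply: eq_bigr => i _; ring.
Qed.

(** Multiplications by [u] and by [v] commute. *)
Lemma iter_twist_mull v F m :
  iter m twist (fun x => F (v * x)) = fun x => iter m twist F (v * x).
Proof. by elim: m => //= m ->; apply/funext => x; rewrite /twist mulrCA. Qed.

(** Since j (u x) = j u * j x, the function c * j is an eigenfunction of the twist, with eigenvalue
    j u - b. *)
Lemma iter_twist_eigen (j : {rmorphism K -> C}) c m :
  iter m twist (fun x => c * j x) = fun x => (j u - b) ^+ m * (c * j x).
Proof.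
elim: m => /= [|m ->]; apply/funext => x; first by rewrite mul1r.
by rewrite /twist rmorphM exprS; ring.
Qed.

End Twist.

Lemma iter_twist_rmorph (K C C' : comNzRingType) (phi : {rmorphism C -> C'})
    (u : K) (b : C) (F : K -> C) m :
  iter m (twist u (phi b)) (phi \o F) = phi \o iter m (twist u b) F.
Proof.
by elim: m => //= m ->; apply/funext => x; rewrite /twist /= rmorphB rmorphM.
Qed.

(** * Nilpotency of the twist on differential operators *)

Section DifferentialOperators.
Variable C : numFieldType.

(** A derivation raises the order by at most one: by the Leibniz rule, twist (d o F) = d o (twist F)
    + d b * F, and induction on [m] applies to twist F. *)
Lemma iter_twist_derivation (K : comNzRingType) (S : divringClosed C)
    (d : C -> C) (u : K) (b : C) (F : K -> C) m :
  derivation_on [set` S] d -> b \in S -> (forall x, F x \in S) ->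
  iter m (twist u b) F = (fun=> 0) ->
  iter m.+1 (twist u b) (d \o F) = fun=> 0.
Proof.
move=> d_der bS; have [_ dD dM] := d_der.
have d0 : d 0 = 0 by apply: derivation_on0 d_der; rewrite /= rpred0.
elim: m F => [|m IHm] F FS F0.
  rewrite -[F]/(iter 0 (twist u b) F) F0; apply/funext => x /=.
  by rewrite /twist /= d0 mulr0 subr0.
have tFS x : twist u b F x \in S by rewrite rpredB ?rpredM.
have -> : iter m.+2 (twist u b) (d \o F) =
    iter m.+1 (twist u b) (fun x => (d \o twist u b F) x + d b * F x).
  rewrite iterSr; congr iter; apply/funext => x /=; rewrite {1}/twist /=.
  have -> : F (u * x) = twist u b F x + b * F x by rewrite /twist subrK.
  by rewrite dD ?dM /= ?rpredM //; ring.
rewrite iter_twistD_scale F0 IHm // -?iterSr //.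
by apply/funext => x; rewrite mulr0 addr0.
Qed.

Section Operators.
Variables (S : {pred C}) (K : subFieldType S) (k : nat) (d : 'I_k -> C -> C).
Hypothesis d_der : forall j, derivation_on [set` S] (d j).

(** The three facts are proved in one induction on the composition, because additivity and the
    Leibniz rule for the next derivation require arguments in [S]. Each derivation adds one to the
    nilpotency exponent. *)
Lemma monomial_opP (j : 'I_k -> nat) :
  [/\ {in S, forall x, monomial_op d j x \in S},
      {in S &, {morph monomial_op d j : x y / x + y}}
    & forall u : K, exists m,
        iter m (twist u (val u)) (monomial_op d j \o val) = fun=> 0].
Proof.
rewrite /monomial_op; elim/big_rec: _ => [|i f _ [fS fD fN]].
  (* The empty composition is the inclusion of K, which commutes with multiplication by u, so a
     single twist kills it. *)
  split=> // u; exists 1%N; apply/funext => x.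
  by rewrite /= /twist /= rmorphM subrr.
elim: (j i) => [//|m [gS gD gN]].
have [dS dD _] := d_der i.
split=> [x xS|x y xS yS|u].
- by apply: dS; apply: gS.
- have /= -> := gD x y xS yS.
  exact: dD (gS x xS) (gS y yS).
have [N gN0] := gN u; exists N.+1.
apply: (@iter_twist_derivation K (subfield_pred K)) gN0 => //.
  by apply: valP.
by move=> x; apply: gS; apply: valP.
Qed.

Variables (J : 'I_k -> nat) (c : {dffun forall i : 'I_k, 'I_(J i).+1} -> C).

Lemma diff_op_additive : is_additive (diff_op (K := K) d c).
Proof.
move=> x y; rewrite /diff_op -big_split; apply: eq_bigr => j _ /=.
have [_ MD _] := monomial_opP (fun i => j i).
by rewrite rmorphD MD ?mulrDr //; apply: valP.
Qed.

Lemma diff_op_twist_nilpotent (u : K) :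
  exists m, iter m (twist u (val u)) (diff_op (K := K) d c) = fun=> 0.
Proof.
have ex_m (j : {dffun forall i : 'I_k, 'I_(J i).+1}) : exists m,
    iter m (twist u (val u)) (monomial_op d (fun i => j i) \o val) = fun=> 0.
  by have [_ _] := monomial_opP (fun i => j i); apply.
(* The sum of the exponents dominates each of them, hence serves all terms at once. *)
have [m m0] := fin_all_exists ex_m; exists (\sum_j m j)%N.
rewrite /diff_op iter_twist_sum; apply/funext => x.
apply: big1 => j _; rewrite (iter_twist_eq0W _ (m0 j)) ?mulr0 //.
by rewrite (bigD1 j) //= leq_addr.
Qed.

(** The monomials in the derivations take values in [S], where [phi] is the identity, so [phi] acts
    only on the coefficients. *)
Lemma comp_diff_op (phi : {rmorphism C -> C}) :
  {in S, phi =1 id} ->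
  phi \o diff_op (K := K) d c = diff_op (K := K) d (phi \o c).
Proof.
move=> phi_id; apply/funext => x; rewrite /= /diff_op rmorph_sum.
apply: eq_bigr => j _; rewrite rmorphM; congr (_ * _); apply: phi_id.
by have [MS _ _] := monomial_opP (fun i => j i); apply: MS; apply: valP.
Qed.

Lemma rmorph_id_of_diff_op_sol (n : nat) (a : 'I_n -> C)
    (alpha beta : 'I_n -> K) (phi : {rmorphism C -> C}) (ct : C) :
  ct != 0 -> solves a alpha beta ct (phi \o diff_op (K := K) d c) ->
  {in S, phi =1 id}.
Proof.
move=> ct_neq0 D_sol s sS; set D := diff_op d c in D_sol.
pose u : K := Sub s sS; have su : s = val u by rewrite SubK.
have [m Dm0] := diff_op_twist_nilpotent u.
(* This is the equation at y = 0. *)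
have ctE : (fun x : K => ct * val x) =
    fun x => \sum_i a i * (phi \o D) (alpha i * x).
  apply/funext => x; have := D_sol x 0; rewrite rmorph0 addr0 => <-.
  by apply: eq_bigr => i _; rewrite mulr0 addr0.
(* Twisting m times kills the sum and multiplies ct * val by (s - phi s)^m; at x = 1 this reads (s -
   phi s)^m * ct = 0. *)
have := iter_twist_eigen u (phi s) (val : {rmorphism K -> C}) ct m.
rewrite ctE iter_twist_sum => /(congr1 (fun F => F 1)).
rewrite big1 => [|i _]; last first.
  by rewrite iter_twist_mull su iter_twist_rmorph Dm0 /= rmorph0 mulr0.
move/esym/eqP; rewrite rmorph1 mulr1 mulf_eq0 (negbTE ct_neq0) orbF.
by rewrite expf_eq0 subr_eq0 /= -su => /andP[_ /eqP].
Qed.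

End Operators.
End DifferentialOperators.

(** * Description of the solution set *)

Local Open Scope complex_scope.

Theorem corollary3p11 (R : realType) (S : {pred R[i]}) (K : subFieldType S)
    (n k : nat) (a : 'I_n -> R[i]) (alpha beta : 'I_n -> K)
    (t : 'I_k -> R[i]) (d : 'I_k -> R[i] -> R[i])
    (phi : {rmorphism R[i] -> R[i]}) (J : 'I_k -> nat)
    (coef : {dffun forall i : 'I_k, 'I_(J i).+1} -> R[i]) (ct : R[i])
    (n_ge1 : (1 <= n)%N) (k_ge1 : (1 <= k)%N)
    (trdeg_k : has_trdeg
       (field_gen (range (val \o alpha) `|` range (val \o beta))) k)
    (t_indep : alg_independent t)
    (alpha_alg : forall i, alg_closure (field_gen (range t)) (val (alpha i)))
    (beta_alg : forall i, alg_closure (field_gen (range t)) (val (beta i)))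
    (K_fg : finitely_generated [set` S])
    (L_sub_K : field_gen (range t) `<=` [set` S])
    (K_alg : [set` S] `<=` alg_closure (field_gen (range t)))
    (d_der : forall j, derivation_on (alg_closure (field_gen (range t))) (d j))
    (d_partial : forall j, is_partial t j (d j))
    (phi_bij : bijective phi)
    (phi_S1 : S1_star a alpha beta (restr_star (phi \o val : K -> R[i])))
    (ct_neq0 : ct != 0)
    (D_sol : solves a alpha beta ct (phi \o diff_op (K := K) d coef)) :
  forall c : R[i],
    [set f : K -> R[i] | is_additive f /\ solves a alpha beta c f] =
    [set (fun x => c / ct * diff_op (K := K) d (phi \o coef) x + g x)
       | g in S1_0 a alpha beta].
Proof.
(* The partial derivatives preserve Q(t), hence also K, which is algebraic over it. *)
have d_derS j : derivation_on [set` S] (d j).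
  apply: (@derivation_algebraic _ (field_gen_pred (range t)) (subfield_pred K)
    _ _ (d_der j)) => [x xS|x /set_mem xL||x xS].
  - by apply/mem_set/K_alg.
  - exact: L_sub_K.
  - exact: partial_field_gen (d_partial j).
  - exact: K_alg.
have phi_id := rmorph_id_of_diff_op_sol d_derS ct_neq0 D_sol.
(* From here on D^phi itself is the particular solution with constant [ct]. *)
rewrite (comp_diff_op K d_derS _ phi_id) in D_sol.
set D := diff_op d (phi \o coef) in D_sol *.
have D_add : is_additive D by apply: diff_op_additive.
move=> c; apply/seteqP; split=> [f [f_add f_sol]|_ [g [[g_add _] g_sol] <-]].
  (* The equation is linear in the function and its constant: subtracting c / ct times D^phi cancels
     the constant [c]. *)
  have g_sol : solves a alpha beta 0 (fun x => f x - c / ct * D x).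
    move=> x y; under eq_bigr do rewrite mulrBr mulrCA.
    rewrite sumrB -mulr_sumr f_sol D_sol.
    by rewrite mulrA divfK // subrr mul0r.
  exists (fun x => f x - c / ct * D x); last first.
    by apply/funext => x; rewrite addrC subrK.
  split=> //; split; last by exists 0.
  by move=> x y; rewrite f_add D_add; ring.
split=> [x y|x y]; first by rewrite D_add g_add; ring.
under eq_bigr do rewrite mulrDr mulrCA.
by rewrite big_split /= -mulr_sumr g_sol D_sol mulrA divfK // mul0r addr0.
Qed.
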